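(* Let $\delta>0$ and $\epsilon>0$, and select $\alpha\in(0,1)$ and $c>0$ such that $c>-4\ln(\alpha)$. Let $A\in\mathbb{R}^{m\times n}$, let $CUR\in\mathbb{R}^{m\times n}$ be a CUR approximation of $A$, and let $G\in\mathbb{R}^{c\times m}$ be a random matrix with independent Gaussian entries of mean zero and variance $1/c$. If $$\xi=(1+\delta)\sqrt{1-2\sqrt{-\ln(\alpha)/c}},$$ then $$\mathbb{P}\left[\frac{\|G(A-CUR)\|_F}{\|A\|_F}<\xi\,\epsilon\ \text{ and }\ \frac{\|A-CUR\|_F}{\|A\|_F}>(1+\delta)\,\epsilon\right]\le\alpha .$$
   Context: $\|\cdot\|_F$ is the Frobenius norm and $\ln$ the natural logarithm; $c$ is the number of rows of $G$. A CUR approximation of $A\in\mathbb{R}^{m\times n}$ is a product $CUR$ with $C=A(:,J)$ a set of columns of $A$ (column index set $J$), $R=A(I,:)$ a set of rows of $A$ (row index set $I$), and $U=A(I,J)^\dagger$ the Moore–Penrose pseudoinverse of the submatrix of $A$ at the intersection of these rows and columns. The result is intended as a stopping rule for an iterative algorithm (IterativeCUR) that builds $CUR$ by repeatedly selecting new column indices from the sketched residual $G(A-CUR)$, with one sketching matrix $G$ reused in all iterations, and that uses $\|G(A-CUR)\|_F$ as an estimate of $\|A-CUR\|_F$. *)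

(* Defs.v *)
From HB Require Import structures.
From mathcomp Require Import all_boot all_order all_algebra.
From mathcomp Require Import all_classical all_reals all_analysis.

Set Implicit Arguments.
Unset Strict Implicit.
Unset Printing Implicit Defensive.

Import Order.TTheory GRing.Theory Num.Theory.

Local Open Scope classical_set_scope.
Local Open Scope ring_scope.

Section matrices.
Variable R : realType.

Definition frobenius m n (M : 'M[R]_(m, n)) : R :=
  Num.sqrt (\sum_i \sum_j M i j ^+ 2).

(* The four Penrose equations. *)
Definition is_moore_penrose m n (M : 'M[R]_(m, n)) (X : 'M[R]_(n, m)) : Prop :=
  [/\ M *m X *m M = M, X *m M *m X = X,
      (M *m X)^T = M *m X & (X *m M)^T = X *m M].

(* Not mxalgebra's [pinvmx], which is only a generalized inverse. *)
Definition moore_penrose m n (M : 'M[R]_(m, n)) : 'M[R]_(n, m) :=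
  xget 0 [set X | is_moore_penrose M X].

(* A(I, :), A(:, J) and A(I, J); the index sets are listed in increasing order. *)
Definition rows_of m n (A : 'M[R]_(m, n)) (I : {set 'I_m}) : 'M[R]_(#|I|, n) :=
  rowsub (fun i : 'I_#|I| => enum_val i) A.

Definition cols_of m n (A : 'M[R]_(m, n)) (J : {set 'I_n}) : 'M[R]_(m, #|J|) :=
  colsub (fun j : 'I_#|J| => enum_val j) A.

Definition cross_of m n (A : 'M[R]_(m, n)) (I : {set 'I_m}) (J : {set 'I_n}) :
  'M[R]_(#|I|, #|J|) := rows_of (cols_of A J) I.

Definition CUR m n (A : 'M[R]_(m, n)) (I : {set 'I_m}) (J : {set 'I_n}) :
    'M[R]_(m, n) :=
  cols_of A J *m moore_penrose (cross_of A I J) *m rows_of A I.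

Lemma gram_unitmx r n (B : 'M[R]_(r, n)) : row_free B -> B *m B^T \in unitmx.
Proof.
move=> Bfree; rewrite -row_free_unit -kermx_eq0.
set K := kermx _; have KB0 : (K *m B) *m (K *m B)^T = 0.
  by rewrite trmx_mul mulmxA -(mulmxA K) mulmx_ker mul0mx.
have /eqP : K *m B = 0.
  apply/matrixP => i j; have := congr1 (fun M : 'M[R]_r => M i i) KB0.
  rewrite !mxE => /eqP; rewrite psumr_eq0 => [|k _]; last first.
    by rewrite [(_^T) _ _]mxE -expr2 sqr_ge0.
  move=> /allP /(_ j (mem_index_enum j)) /=.
  by rewrite [(_^T) _ _]mxE -expr2 sqrf_eq0 mxE => /eqP.
by rewrite mulmx_free_eq0.
Qed.

Lemma moore_penrose_exists m n (M : 'M[R]_(m, n)) :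
  exists X, is_moore_penrose M X.
Proof.
have [r [C [B [CB fC fB]]]] : exists r (C : 'M[R]_(m, r)) (B : 'M[R]_(r, n)),
    [/\ C *m B = M, row_free C^T & row_free B].
  exists (\rank M), (col_base M), (row_base M); split.
  - exact: mulmx_base.
  - by rewrite /row_free mxrank_tr; exact: col_base_full.
  - exact: row_base_free.
have uB : B *m B^T \in unitmx by exact: gram_unitmx.
have uC : C^T *m C \in unitmx by rewrite -{2}(trmxK C); exact: gram_unitmx.
pose P := B^T *m invmx (B *m B^T); pose Q := invmx (C^T *m C) *m C^T.
have BP : B *m P = 1%:M by rewrite mulmxA mulmxV.
have QC : Q *m C = 1%:M by rewrite -mulmxA mulVmx.
have MX : M *m (P *m Q) = C *m Q.
  by rewrite -CB -mulmxA (mulmxA B) BP mul1mx.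
have XM : (P *m Q) *m M = P *m B.
  by rewrite -CB -mulmxA (mulmxA Q) QC mul1mx.
exists (P *m Q); split; rewrite ?MX ?XM.
- by rewrite -CB -mulmxA (mulmxA Q) QC mul1mx.
- by rewrite mulmxA -(mulmxA P) BP mulmx1.
- by rewrite /Q !trmx_mul trmx_inv trmx_mul !trmxK mulmxA.
- by rewrite /P !trmx_mul trmx_inv trmx_mul !trmxK mulmxA.
Qed.

Lemma moore_penroseP m n (M : 'M[R]_(m, n)) :
  is_moore_penrose M (moore_penrose M).
Proof. by have [X XP] := moore_penrose_exists M; exact: xgetI XP. Qed.

Lemma moore_penrose_unique m n (M : 'M[R]_(m, n)) (X Y : 'M[R]_(n, m)) :
  is_moore_penrose M X -> is_moore_penrose M Y -> X = Y.
Proof.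
move=> [X1 X2 X3 X4] [Y1 Y2 Y3 Y4].
have MXY : M *m X = M *m Y.
  have E : M *m X = (M *m Y) *m (M *m X) by rewrite mulmxA Y1.
  by rewrite -X3 E trmx_mul X3 Y3 mulmxA X1.
have XYM : X *m M = Y *m M.
  have E : X *m M = (X *m M) *m (Y *m M) by rewrite -mulmxA (mulmxA M) Y1.
  by rewrite -X4 E trmx_mul X4 Y4 -mulmxA (mulmxA M) X1.
by rewrite -X2 XYM -mulmxA MXY mulmxA Y2.
Qed.

End matrices.

Section gaussian.
Context d (T : measurableType d) (R : realType) (P : probability T R).

(* Mutual independence: the product rule over every finite subfamily. *)
Definition mutually_independent (K : finType) (X : K -> {RV P >-> R}) : Prop :=
  forall (S : {set K}) (B : K -> set R),
    (forall k, measurable (B k)) ->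
    P (\bigcap_(k in [set` S]) X k @^-1` B k) =
    (\prod_(k in S) P (X k @^-1` B k))%E.

(* [normal_prob] is parameterized by the standard deviation. *)
Definition gaussian_rv (X : {RV P >-> R}) (mu var : R) : Prop :=
  forall B : set R, measurable B ->
    distribution P X B = normal_prob mu (Num.sqrt var) B.

Definition gaussian_matrix c m (g : 'I_c -> 'I_m -> {RV P >-> R}) (var : R) :
    Prop :=
  mutually_independent (fun k : 'I_c * 'I_m => g k.1 k.2) /\
  forall i j, gaussian_rv (g i j) 0 var.

Definition random_mx c m (g : 'I_c -> 'I_m -> {RV P >-> R}) (w : T) :
  'M[R]_(c, m) := \matrix_(i, j) g i j w.

End gaussian.

(* Main.v *)
(* Write E = A - CUR and t = - ln alpha; the result is the lower-tail bound
   P(|G E|^2 < (1 - 2 sqrt (t / c)) |E|^2) <= exp (- t).  By Chernoff it follows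
   from the bound (1 + 2 s |E|^2 / c)^(- c / 2) on the expectation of
   exp (- s |G E|^2) at s = sqrt (t c) / |E|^2, together with
   ln (1 + x) >= x - x^2 / 2.
   Diagonalizing E is avoided: for a row g_i of G, |g_i E|^2 is a convex
   combination of the squares of the Gaussians |E| <g_i, e> over the normalized
   columns e of E, so convexity of exp reduces the Laplace transform to forms
   sum_i a_i <g_i, e_i>^2.  These are integrated one entry of G at a time, with
   Fubini applied to the law of that entry and to the sigma-algebra generated by
   the entries that remain. *)
Require Import Defs.
From HB Require Import structures.
From mathcomp Require Import all_boot all_order all_algebra.
From mathcomp Require Import all_classical all_reals all_analysis.
From mathcomp Require Import measurable_realfun ring lra.

Set Implicit Arguments.
Unset Strict Implicit.
Unset Printing Implicit Defensive.

Import Order.TTheory GRing.Theory Num.Theory.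
Import numFieldNormedType.Exports.
Local Open Scope classical_set_scope.
Local Open Scope ring_scope.

(** * Elementary inequalities for the logarithm and the exponential *)

Section inequalities.
Context (R : realType).

(** The difference of the two sides vanishes at 0 and has derivative [y ^+ 2 / (1 + y)], so it is
    nondecreasing on the nonnegative half-line. *)
Lemma ln1D_ge (x : R) : 0 <= x -> x - x ^+ 2 / 2 <= ln (1 + x).
Proof.
move=> x0; rewrite -subr_ge0.
pose f (y : R) := ln (1 + y) - (y - y ^+ 2 / 2).
have df (y : R) : 0 <= y -> is_derive y 1 f ((1 + y)^-1 - (1 - y)).
  move=> y0; rewrite /f.
  have y1 : 0 < 1 + y by rewrite ltr_pwDl.
  have h1 : is_derive y 1 (fun y : R => ln (1 + y)) (1 + y)^-1.
    have := @is_derive1_comp _ (@ln R) (fun y => 1 + y) y _ _ (is_derive1_ln y1).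
    rewrite -[in X in _ -> X](mulr1 (1 + y)^-1); apply.
    by apply: is_derive_eq; rewrite add0r mulr1.
  have h2 : is_derive y 1 (fun y : R => y - y ^+ 2 / 2) (1 - y).
    by apply: is_derive_eq; rewrite /GRing.scale/=; field.
  exact: is_deriveB.
have -> : 0 = f 0 by rewrite /f addr0 ln1 expr0n mul0r !subr0.
apply: (@ger0_derive1_ndecry _ f 0) => //.
- by move=> y; rewrite in_itv/= andbT => /ltW /df [].
- move=> y; rewrite in_itv/= andbT => y0; rewrite derive1E.
  have [_ ->] := df y (ltW y0).
  have y1 : 0 < 1 + y by rewrite ltr_pwDl// ltW.
  have -> : (1 + y)^-1 - (1 - y) = y ^+ 2 / (1 + y).
    by field; rewrite gt_eqF.
  by rewrite divr_ge0 ?sqr_ge0// ltW.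
- apply: derivable_within_continuous => y; rewrite in_itv/= andbT.
  by move=> /df [].
Qed.

Lemma sqrt1D_inv_le (x : R) : 0 <= x ->
  (Num.sqrt (1 + x))^-1 <= expR (- (x / 2) + x ^+ 2 / 4).
Proof.
move=> x0; have x1 : 0 < 1 + x by rewrite ltr_pwDl.
have -> : (Num.sqrt (1 + x))^-1 = expR (- (ln (1 + x) / 2)).
  have {1}-> : 1 + x = expR (ln (1 + x) / 2) ^+ 2.
    by rewrite -expRM_natl mulrC divfK ?lnK ?posrE// pnatr_eq0.
  by rewrite sqrtr_sqr ger0_norm ?expR_ge0// expRN.
by rewrite ler_expR; have := ln1D_ge x0; lra.
Qed.

Lemma expR_jensen (I : finType) (p y : I -> R) :
  (forall i, 0 <= p i) -> \sum_i p i = 1 ->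
  expR (\sum_i p i * y i) <= \sum_i p i * expR (y i).
Proof.
move=> p0 p1; set mean := \sum_i p i * y i.
(* Averaged with the weights [p], the tangent line of [expR] at [mean] gives back [expR mean]; each
   term is then compared with its tangent. *)
have -> : expR mean = \sum_i p i * (expR mean * (1 + (y i - mean))).
  transitivity (expR mean * (\sum_i p i * y i + (1 - mean) * \sum_i p i)).
    by rewrite p1 -/mean; ring.
  rewrite big_distrr -big_split big_distrr /=; apply: eq_bigr => i _; ring.
apply: ler_sum => i _; apply: ler_wpM2l => //.
have -> : expR (y i) = expR mean * expR (y i - mean).
  by rewrite -expRD subrKC.
by rewrite ler_pM2l ?expR_gt0// expR_ge1Dx.
Qed.
End inequalities.

(** * Independence of one variable from the sigma-algebra of the others *)

Section independence.
Context d (T : measurableType d) (R : realType) (P : probability T R).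
Context (K : finType) (X : K -> {RV P >-> R}).

(** A pi-system generating the sigma-algebra of the [X k] with [k] in [S]. The space [T] with this
    coarser sigma-algebra plays the part of the space of values of these variables. *)
Definition cylinders (S : {set K}) : set (set T) :=
  [set A | exists2 B : K -> set R, forall k, measurable (B k) &
           A = \bigcap_(k in [set` S]) X k @^-1` B k].

Local Notation TS S := (g_sigma_algebraType (cylinders S)).

Lemma cylinders_setI_closed (S : {set K}) : setI_closed (cylinders S).
Proof.
move=> _ _ [B mB ->] [C mC ->]; exists (fun k => B k `&` C k).
  by move=> k; exact: measurableI.
by rewrite -bigcapI; apply: eq_bigcapr => k _; rewrite preimage_setI.
Qed.

Lemma cylinders_setT (S : {set K}) : cylinders S setT.
Proof.
exists (fun=> setT) => [k|]; first exact: measurableT.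
by apply/esym; rewrite -subTset => w _ k _.
Qed.

Lemma measurable_cylinder (S : {set K}) (B : K -> set R) :
  (forall k, measurable (B k)) ->
  measurable (\bigcap_(k in [set` S]) X k @^-1` B k).
Proof.
move=> mB; apply: fin_bigcap_measurable; first exact: finite_finset.
by move=> k _; rewrite -[_ @^-1` _]setTI; exact: measurable_funP.
Qed.

Lemma sub_cylinders_measurable (S : {set K}) :
  <<s cylinders S >> `<=` @measurable _ T.
Proof.
apply: smallest_sub; first exact: sigma_algebra_measurable.
by move=> _ [B mB ->]; exact: measurable_cylinder.
Qed.

Lemma measurable_id_cylinders (S : {set K}) :
  measurable_fun setT (idfun : T -> TS S).
Proof.
by move=> _ A mA; rewrite setTI preimage_id; exact: sub_cylinders_measurable mA.
Qed.

Lemma measurable_fun_cylinders (S : {set K}) k : k \in S ->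
  measurable_fun setT (X k : TS S -> R).
Proof.
move=> kS _ A mA; rewrite setTI; apply: sub_sigma_algebra.
exists (fun j => if j == k then A else setT) => [j|].
  by case: ifP => // _; exact: measurableT.
apply/seteqP; split => [w Aw j _ /=|w /(_ k)/=].
  by case: eqP => [->|].
by rewrite eqxx; exact.
Qed.

Hypothesis X_indep : mutually_independent X.

(** As functions of [B], both sides are finite measures: a restriction of [P] and a multiple of [P].
    They agree on the cylinders by mutual independence, hence on the generated sigma-algebra. *)
Lemma cylinders_indep (S : {set K}) k (A : set R) (B : set T) :
  k \notin S -> measurable A -> <<s cylinders S >> B ->
  P (X k @^-1` A `&` B) = (P (X k @^-1` A) * P B)%E.
Proof.
move=> kS mA sB.
have mXA : measurable (X k @^-1` A).
  by rewrite -[_ @^-1` _]setTI; exact: measurable_funP.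
have PA_ge0 : 0 <= fine (P (X k @^-1` A)) by rewrite fine_ge0.
pose m1 : {measure set T -> \bar R} := mrestr P mXA.
pose m2 : {measure set T -> \bar R} := mscale (NngNum PA_ge0) P.
suff : m1 B = m2 B.
  by rewrite /m1 /m2 /= /mrestr /mscale /= fineK ?fin_num_measure// setIC.
apply: (g_sigma_algebra_measure_unique (cylinders S) _ (fun=> setT)) => //.
- by move=> _ [C mC ->]; exact: measurable_cylinder.
- by move=> _; exact: cylinders_setT.
- by apply: bigcup_const; exists 0%N.
- exact: cylinders_setI_closed.
- move=> _ [C mC ->]; rewrite /m1 /m2 /= /mrestr /mscale /= fineK ?fin_num_measure//.
  (* Since [k] is outside [S], a cylinder over [S] together with a condition on [X k] is a cylinder
     over [k |: S], with sides [D]. *)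
  pose D j := if j == k then A else C j.
  have mD j : measurable (D j) by rewrite /D; case: ifP.
  have -> : \bigcap_(j in [set` S]) X j @^-1` C j `&` X k @^-1` A =
      \bigcap_(j in [set` (k |: S)%SET]) X j @^-1` D j.
    apply/seteqP; split => [w [Cw Aw] j /=|w Dw].
      by rewrite in_setU1 /D; case: eqP => [->//|_ /=]; exact: Cw.
    split=> [j /= jS|].
      have := Dw j; rewrite /= in_setU1 jS orbT /D; case: eqP => [jk|_]; last exact.
      by move: kS; rewrite -jk jS.
    by have := Dw k; rewrite /= setU11 /D eqxx; exact.
  rewrite !X_indep// big_setU1//= /D eqxx; congr (_ * _)%E.
  by apply: eq_bigr => j jS; case: eqP => // jk; move: kS; rewrite -jk jS.
- by move=> _; rewrite /m1 /= /mrestr setTI (le_lt_trans (probability_le1 P mXA)) ?ltry.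
Qed.

(** By independence the joint law of [X k] and the identity into [TS S] is a product measure, so
    Tonelli integrates [X k] out while [w] is frozen in the second argument. *)
Lemma integral_indep (S : {set K}) k (h : R * TS S -> \bar R) :
  k \notin S -> measurable_fun setT h -> (forall z, 0 <= h z)%E ->
  (\int[P]_w h (X k w, w) =
   \int[P]_w \int[distribution P (X k)]_x h (x, w))%E.
Proof.
move=> kS mh h0.
have mid := @measurable_id_cylinders S.
pose idm : {mfun T >-> TS S} := HB.pack (idfun : T -> TS S)
  (isMeasurableFun.Build _ _ _ _ _ mid).
pose phi (w : T) : R * TS S := (X k w, w).
have mphi : measurable_fun setT phi by apply: measurable_fun_pair.
pose phim : {mfun T >-> (R * TS S)%type} := HB.pack phi
  (isMeasurableFun.Build _ _ _ _ _ mphi).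
transitivity (\int[distribution P phim]_z h z)%E.
  by rewrite ge0_integral_pushforward.
transitivity (\int[distribution P (X k) \x distribution P idm]_z h z)%E.
  apply: eq_measure_integral => A mA _; apply/esym.
  apply: product_measure_unique => // B C mB mC.
  exact: (cylinders_indep kS mB mC).
rewrite fubini_tonelli2//.
rewrite ge0_integral_pushforward//.
- exact: measurable_fun_fubini_tonelli_G.
- by move=> w _; apply: integral_ge0.
Qed.

End independence.

(** * Gaussian integrals of exponentials of squares *)

Section normal_integral.
Context (R : realType).
Local Notation mu := (@lebesgue_measure R).

(** The density and the Radon-Nikodym derivative have the same integral over every measurable set,
    so they agree almost everywhere. *)
Lemma integral_normal_prob (m s : R) (f : R -> \bar R) : 
  (normal_prob m s).-integrable setT f ->
  (\int[normal_prob m s]_x f x = \int[mu]_x (f x * (normal_pdf m s x)%:E))%E.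
Proof.
move=> intf; have dom := normal_prob_dominates m s.
have mpdf : measurable_fun setT (fun x => (normal_pdf m s x)%:E).
  by apply/measurable_EFinP; exact: measurable_normal_pdf.
rewrite -(Radon_Nikodym_change_of_variables dom)//=.
apply: ae_eq_integral => //.
- by apply: emeasurable_funM => //; exact: measurable_int intf.
- by apply: emeasurable_funM => //; exact: measurable_int intf.
apply: ae_eqe_mul2l => /=.
rewrite Radon_NikodymE//=.
case: cid => /= h [h1 h2 h3].
apply: integral_ae_eq => //=.
by move=> E _ mE; rewrite -h3.
Qed.

(** Completing the square in [z] leaves a Gaussian density of variance [s ^+ 2 / q]. The remaining
    factor has the same shape in [x], with [a / q] for [a], so the step can be iterated. *)
Lemma normal_pdf_sqr (a e x r s z : R) : 0 <= a -> s != 0 ->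
  let q := 1 + 2 * a * s ^+ 2 * e ^+ 2 in
  expR (- (a * (x + e * z) ^+ 2 + r)) * normal_pdf 0 s z =
  (Num.sqrt q)^-1 * expR (- (a / q * x ^+ 2 + r)) *
  normal_pdf (- (2 * a * e * x * s ^+ 2 / q)) (s / Num.sqrt q) z.
Proof.
move=> a0 s0 q.
have q_gt0 : 0 < q.
  by rewrite ltr_pwDl// mulr_ge0 ?sqr_ge0// mulr_ge0 ?sqr_ge0// mulr_ge0.
have q0 : q != 0 by rewrite gt_eqF.
have sq_gt0 : 0 < Num.sqrt q by rewrite sqrtr_gt0.
have sq0 : Num.sqrt q != 0 by rewrite gt_eqF.
rewrite !normal_pdfE ?mulf_neq0 ?invr_eq0//.
rewrite /normal_fun /normal_peak.
have s2 : (s / Num.sqrt q) ^+ 2 = s ^+ 2 / q.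
  by rewrite expr_div_n sqr_sqrtr ?ltW.
rewrite !s2.
have -> : Num.sqrt (s ^+ 2 / q * pi *+ 2) = Num.sqrt (s ^+ 2 * pi *+ 2) / Num.sqrt q.
  have -> : s ^+ 2 / q * pi *+ 2 = (s ^+ 2 * pi *+ 2) * q^-1 by ring.
  rewrite sqrtrM ?sqrtrV ?(ltW q_gt0)//.
  by rewrite mulrn_wge0// mulr_ge0 ?sqr_ge0 ?pi_ge0.
rewrite invf_div mulrCA -expRD.
transitivity ((Num.sqrt (s ^+ 2 * pi *+ 2))^-1 *
   expR (- (a / q * x ^+ 2 + r) + - (z - - (2 * a * e * x * s ^+ 2 / q)) ^+ 2 / (s ^+ 2 / q *+ 2))).
  congr (_ * expR _); rewrite subr0 !mulr2n; move: q0; rewrite /q => q0.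
  field; rewrite q0 /= -mulr2n mulrn_eq0 /=.
  by rewrite expf_eq0 s0.
rewrite expRD; move: (expR _) (expR _) (Num.sqrt (_ *+ 2))^-1 => A B C.
by field.
Qed.

Lemma measurable_expR_sqr (a e x r : R) :
  measurable_fun setT (fun z => (expR (- (a * (x + e * z) ^+ 2 + r)))%:E).
Proof.
apply/measurable_EFinP; apply: measurableT_comp => //.
apply: measurableT_comp => //.
apply: measurable_funD => //; apply: measurable_funM => //.
by apply: measurable_funX; apply: measurable_funD => //; exact: measurable_funM.
Qed.

Lemma integral_normal_expR_sqr (a e x r s : R) : 0 <= a -> s != 0 ->
  let q := 1 + 2 * a * s ^+ 2 * e ^+ 2 in
  (\int[normal_prob 0 s]_z (expR (- (a * (x + e * z) ^+ 2 + r)))%:E =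
   ((Num.sqrt q)^-1 * expR (- (a / q * x ^+ 2 + r)))%:E)%E.
Proof.
move=> a0 s0 q.
rewrite integral_normal_prob; last first.
  apply: (le_integrable measurableT (g := cst (expR (- r))%:E)).
  - exact: measurable_expR_sqr.
  - move=> z _ /=; rewrite !ger0_norm ?expR_ge0// lee_fin ler_expR lerN2 lerDr.
    by rewrite mulr_ge0 ?sqr_ge0.
  - exact: finite_measure_integrable_cst.
under eq_integral => z _ do rewrite -EFinM normal_pdf_sqr// EFinM.
rewrite ge0_integralZl//.
- by rewrite integral_normal_pdf mule1.
- by apply/measurable_EFinP; exact: measurable_normal_pdf.
- by move=> z _; rewrite lee_fin normal_pdf_ge0.
Qed.

End normal_integral.

(** * Laplace transform of a Gaussian quadratic form *)

Section gaussian_quadratic_form.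
Context d (T : measurableType d) (R : realType) (P : probability T R).
Context (c m : nat) (g : 'I_c -> 'I_m -> {RV P >-> R}) (v : R).
Hypothesis v_gt0 : 0 < v.
Hypothesis g_gaussian : gaussian_matrix g v.

Local Notation K := ('I_c * 'I_m)%type.
Local Notation X := (fun k : K => g k.1 k.2).

(** The entries in [S] are those still to be integrated out; for full [S] this is the inner product
    of row [i] of the Gaussian matrix with [e i]. *)
Definition partial_row (e : 'I_c -> 'I_m -> R) (S : {set K}) i w :=
  \sum_(j | (i, j) \in S) e i j * g i j w.

Lemma partial_row_mkcond e (S : {set K}) i :
  partial_row e S i =
  (fun w => \sum_j if (i, j) \in S then e i j * g i j w else 0).
Proof. by apply/funext => w; rewrite /partial_row big_mkcond. Qed.

Lemma measurable_partial_row e (S : {set K}) i :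
  measurable_fun setT (partial_row e S i : g_sigma_algebraType (cylinders X S) -> R).
Proof.
rewrite partial_row_mkcond.
apply: measurable_sum => j; case: (boolP ((i, j) \in S)) => ijS //.
by apply: measurable_funM => //; exact: (@measurable_fun_cylinders _ _ _ _ _ X S (i, j)).
Qed.

Lemma sum_row_setD1 (F : 'I_c -> 'I_m -> R) (S : {set K}) i j i' :
  (i, j) \in S ->
  \sum_(j' | (i', j') \in S) F i' j' =
  \sum_(j' | (i', j') \in S :\ (i, j)) F i' j' +
    (if i' == i then F i j else 0).
Proof.
move=> ijS; case: eqP => [->|/eqP i'i].
  rewrite (bigD1 j)//= addrC; congr (_ + _); apply: eq_bigl => j'.
  by rewrite in_setD1 xpair_eqE eqxx /= andbC.
rewrite addr0; apply: eq_bigl => j'.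
by rewrite in_setD1 xpair_eqE (negbTE i'i).
Qed.

Lemma partial_row_setD1 e (S : {set K}) i j i' w : (i, j) \in S ->
  partial_row e S i' w = partial_row e (S :\ (i, j)) i' w +
    (if i' == i then e i j * g i j w else 0).
Proof. exact: (sum_row_setD1 (fun i j => e i j * g i j w)). Qed.

Lemma integral_distribution_expR_sqr i j (a e x r : R) : 0 <= a ->
  let q := 1 + 2 * a * v * e ^+ 2 in
  (\int[distribution P (g i j)]_z (expR (- (a * (x + e * z) ^+ 2 + r)))%:E =
   ((Num.sqrt q)^-1 * expR (- (a / q * x ^+ 2 + r)))%:E)%E.
Proof.
move=> a0 /=.
transitivity (\int[normal_prob 0 (Num.sqrt v)]_z
    (expR (- (a * (x + e * z) ^+ 2 + r)))%:E)%E.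
  (* [R] and [measurableTypeR R] carry the same sigma-algebra under different
     displays; the first is the codomain of [g i j], the second the domain of
     [normal_prob]. *)
  have mg : measurable_fun setT (g i j : T -> measurableTypeR R).
    by move=> mT A mA; exact: (measurable_funP (g i j)).
  pose gm : {mfun T >-> measurableTypeR R} := HB.pack (g i j : T -> measurableTypeR R)
    (isMeasurableFun.Build _ _ _ _ _ mg).
  transitivity (\int[distribution P gm]_z
      (expR (- (a * (x + e * z) ^+ 2 + r)))%:E)%E.
    rewrite !ge0_integral_distribution//;
      by [exact: measurable_expR_sqr | move=> z; rewrite lee_fin expR_ge0].
  by apply: eq_measure_integral => A mA _; exact: g_gaussian.2.
rewrite integral_normal_expR_sqr//; last by rewrite gt_eqF// sqrtr_gt0.
by rewrite sqr_sqrtr ?ltW.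
Qed.

(* Integrating out one entry of row [i] rescales the coefficient [a i], so the
   induction on the set of remaining entries is over all coefficients. *)
Lemma integral_expR_gaussian_form (e : 'I_c -> 'I_m -> R) (S : {set K})
    (a : 'I_c -> R) : (forall i, 0 <= a i) ->
  (\int[P]_w (expR (- \sum_i a i * partial_row e S i w ^+ 2))%:E =
   (\prod_i (Num.sqrt
      (1 + 2 * a i * v * \sum_(j | (i, j) \in S) e i j ^+ 2))^-1)%:E)%E.
Proof.
move En : #|S| => n; elim: n S En a => [|n IHn] S En a a_ge0.
  move/eqP: En; rewrite cards_eq0 => /eqP ->.
  under eq_integral => w _.
    rewrite big1 => [|i _]; last first.
      by rewrite /partial_row big_pred0 ?expr0n ?mulr0// => j; rewrite finset.in_set0.
    rewrite oppr0 expR0; over.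
  rewrite integral_cst// mul1e [LHS]probability_setT big1// => i _.
  rewrite big_pred0 => [|j]; last by rewrite finset.in_set0.
  by rewrite mulr0 addr0 sqrtr1 invr1.
have /finset.set0Pn[[i j] ijS] : S != finset.set0 by rewrite -cards_eq0 En.
pose S' := S :\ (i, j).
have S'n : #|S'| = n by apply/eqP; rewrite -eqSS -En (cardsD1 (i, j) S) ijS.
pose q := 1 + 2 * a i * v * e i j ^+ 2.
have q_gt0 : 0 < q.
  by rewrite ltr_pwDl// mulr_ge0 ?sqr_ge0// mulr_ge0 ?(ltW v_gt0)// mulr_ge0.
pose a' i' := if i' == i then a i / q else a i'.
have a'_ge0 i' : 0 <= a' i'.
  by rewrite /a'; case: ifP => // _; rewrite divr_ge0// ltW.
pose rest w := \sum_(i' | i' != i) a i' * partial_row e S' i' w ^+ 2.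
(* The entry [g i j] becomes the free variable [z.1]; the rest is measurable for the entries in [S']
   and is read off [z.2]. *)
pose h (z : R * g_sigma_algebraType (cylinders X S')) : \bar R :=
  (expR (- (a i * (partial_row e S' i z.2 + e i j * z.1) ^+ 2 + rest z.2)))%:E.
have mrest : measurable_fun setT (rest : g_sigma_algebraType (cylinders X S') -> R).
  rewrite (_ : rest = fun w =>
      \sum_i' if i' != i then a i' * partial_row e S' i' w ^+ 2 else 0).
    apply: measurable_sum => i'; case: (i' != i) => //.
    apply: measurable_funM => //; apply: measurable_funX.
    exact: measurable_partial_row.
  by apply/funext => w; rewrite /rest big_mkcond.
have mh : measurable_fun setT h.
  apply/measurable_EFinP; apply: measurableT_comp => //.
  apply: measurableT_comp => //; apply: measurable_funD.
    apply: measurable_funM => //; apply: measurable_funX.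
    apply: measurable_funD; last exact: measurable_funM.
    by apply: measurableT_comp; [exact: measurable_partial_row|exact: measurable_snd].
  exact: (measurableT_comp mrest measurable_snd).
transitivity (\int[P]_w h (g i j w, w))%E.
  apply: eq_integral => w _; rewrite /h /=; congr (expR (- _))%:E.
  rewrite (bigD1 i)//= (partial_row_setD1 e i w ijS) eqxx; congr (_ + _).
  apply: eq_bigr => i' i'i.
  by rewrite (partial_row_setD1 e i' w ijS) (negbTE i'i) addr0.
rewrite (@integral_indep _ _ _ _ _ X g_gaussian.1 S' (i, j) h)//; last 2 first.
  by rewrite in_setD1 eqxx.
  by move=> z; rewrite lee_fin expR_ge0.
transitivity (\int[P]_w ((Num.sqrt q)^-1%:E *
   (expR (- \sum_i' a' i' * partial_row e S' i' w ^+ 2))%:E))%E.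
  apply: eq_integral => w _; rewrite /h /= integral_distribution_expR_sqr//.
  rewrite -EFinM; congr (_ * expR (- _))%:E.
  rewrite [RHS](bigD1 i)//= /a' eqxx; congr (_ + _).
  by apply: eq_bigr => i' /negbTE ->.
rewrite ge0_integralZl//; last first.
  apply/measurable_EFinP; apply: measurableT_comp => //.
  apply: measurableT_comp => //; apply: measurable_sum => i'.
  apply: measurable_funM => //; apply: measurable_funX.
  rewrite partial_row_mkcond.
  by apply: measurable_sum => j'; case: (_ \in S') => //; exact: measurable_funM.
rewrite IHn// -EFinM; congr (_%:E).
rewrite [in LHS](bigD1 i)//= [in RHS](bigD1 i)//= mulrA; congr (_ * _); last first.
  apply: eq_bigr => i' i'i.
  by rewrite (sum_row_setD1 (fun i j => e i j ^+ 2) i' ijS) /a' (negbTE i'i) addr0.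
(* The factors merge because [q * (1 + 2 * (a i / q) * v * u) = q + 2 * a i * v * u], where [u] sums
   the squares over the remaining entries of row [i]. *)
rewrite -invfM -sqrtrM ?(ltW q_gt0)//; congr (Num.sqrt _)^-1.
rewrite (sum_row_setD1 (fun i j => e i j ^+ 2) i ijS) /a' eqxx -/S'.
by move: q_gt0; rewrite lt0r /q => /andP[q0 _]; field.
Qed.

End gaussian_quadratic_form.

(** * Laplace transform of the squared norm of the sketch *)

Definition sqr_frobenius (R : realType) (m n : nat) (M : 'M[R]_(m, n)) : R :=
  \sum_i \sum_j M i j ^+ 2.

Lemma sqr_frobenius_ge0 (R : realType) (m n : nat) (M : 'M[R]_(m, n)) :
  0 <= sqr_frobenius M.
Proof. by apply: sumr_ge0 => i _; apply: sumr_ge0 => j _; exact: sqr_ge0. Qed.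

Section sketch.
Context d (T : measurableType d) (R : realType) (P : probability T R).
Context (c m n : nat) (g : 'I_c -> 'I_m -> {RV P >-> R}) (v : R).
Hypothesis v_gt0 : 0 < v.
Hypothesis g_gaussian : gaussian_matrix g v.

Lemma measurable_sketch (E : 'M[R]_(m, n)) :
  measurable_fun setT (fun w => sqr_frobenius (random_mx g w *m E)).
Proof.
apply: measurable_sum => i; apply: measurable_sum => k; apply: measurable_funX.
rewrite (_ : (fun w => _) = fun w => \sum_j g i j w * E j k); last first.
  by apply/funext => w; rewrite mxE; apply: eq_bigr => j _; rewrite mxE.
by apply: measurable_sum => j; exact: measurable_funM.
Qed.

Lemma measurable_sketch_lt (E : 'M[R]_(m, n)) (b : R) :
  measurable [set w | sqr_frobenius (random_mx g w *m E) < b].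
Proof.
have := measurable_sketch E measurableT (measurable_itv `]-oo, b[%R).
by rewrite setTI; congr measurable; apply/seteqP; split => w /=; rewrite in_itv.
Qed.

(* The columns [col k E], weighted by [p k = |col k E|^2 / |E|^2], split the
   quadratic form into rank-one forms; convexity of [expR] then replaces the
   singular value decomposition of [E]. *)
Lemma integral_expR_sketch_le (E : 'M[R]_(m, n)) (s : R) :
  0 <= s -> 0 < sqr_frobenius E ->
  (\int[P]_w (expR (- (s * sqr_frobenius (random_mx g w *m E))))%:E <=
   ((Num.sqrt (1 + 2 * s * v * sqr_frobenius E))^-1 ^+ c)%:E)%E.
Proof.
move=> s_ge0; set F := sqr_frobenius E => F_gt0.
have F0 : F != 0 by rewrite gt_eqF.
pose N k := \sum_j E j k ^+ 2; pose p k := N k / F.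
(* Scaled so that [p k * y i k w] is [s] times a squared entry of the sketch, and so that every
   nonzero column yields the same Laplace factor [C]. *)
pose y i k w := s * F / N k * (\sum_j E j k * g i j w) ^+ 2.
pose C := (Num.sqrt (1 + 2 * s * v * F))^-1.
have N_ge0 k : 0 <= N k by apply: sumr_ge0 => j _; exact: sqr_ge0.
have p_ge0 k : 0 <= p k by rewrite divr_ge0// ltW.
have p_sum : \sum_k p k = 1.
  by rewrite -mulr_suml exchange_big /= -/(sqr_frobenius E) divff.
have py i k w : p k * y i k w = s * (random_mx g w *m E) i k ^+ 2.
  have -> : (random_mx g w *m E) i k = \sum_j E j k * g i j w.
    by rewrite mxE; apply: eq_bigr => j _; rewrite mxE mulrC.
  (* If [N k = 0], then [p k] is 0, and so is the sketch entry, since column [k] of [E] vanishes. *)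
  rewrite /p /y; have [Nk0|Nk0] := eqVneq (N k) 0; last by field; rewrite F0 Nk0.
  rewrite Nk0 !mul0r big1 ?expr0n ?mulr0// => j _.
  move/eqP: Nk0; rewrite psumr_eq0 => [/allP/(_ j (mem_index_enum j))|j' _].
    by rewrite /= sqrf_eq0 => /eqP ->; rewrite mul0r.
  exact: sqr_ge0.
have mY (f : {ffun 'I_c -> 'I_n}) :
    measurable_fun setT (fun w => (expR (- \sum_i y i (f i) w))%:E).
  apply/measurable_EFinP; apply: measurableT_comp => //.
  apply: measurableT_comp => //; apply: measurable_sum => i.
  apply: measurable_funM => //; apply: measurable_funX.
  by apply: measurable_sum => j; exact: measurable_funM.
have intY (f : {ffun 'I_c -> 'I_n}) :
    (\int[P]_w (expR (- \sum_i y i (f i) w))%:E =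
     (\prod_i (Num.sqrt (1 + 2 * (s * F / N (f i)) * v * N (f i)))^-1)%:E)%E.
  have a_ge0 i : 0 <= s * F / N (f i) by rewrite divr_ge0// mulr_ge0// ltW.
  have := integral_expR_gaussian_form v_gt0 g_gaussian
    (fun i j => E j (f i)) [set: 'I_c * 'I_m]%SET a_ge0.
  rewrite (_ : \prod_i _ =
    \prod_i (Num.sqrt (1 + 2 * (s * F / N (f i)) * v * N (f i)))^-1).
    move=> <-; apply: eq_integral => w _; congr (expR (- _))%:E.
    apply: eq_bigr => i _; congr (_ * _ ^+ 2).
    by apply: eq_bigl => j; rewrite finset.in_setT.
  apply: eq_bigr => i _; congr (Num.sqrt (1 + _ * _))^-1.
  by apply: eq_bigl => j; rewrite finset.in_setT.
(* Jensen is applied in each row; expanding the product over rows gives a sum over functions [f]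
   that choose one column per row. *)
pose weight (f : {ffun 'I_c -> 'I_n}) := \prod_i p (f i).
have weight_ge0 f : 0 <= weight f by apply: prodr_ge0 => i _.
apply: (@le_trans _ _ (\int[P]_w
    (\sum_(f : {ffun 'I_c -> 'I_n})
      ((weight f)%:E * (expR (- \sum_i y i (f i) w))%:E)))%E).
  apply: ge0_le_integral => //.
  - apply/measurable_EFinP; apply: measurableT_comp => //.
    apply: measurableT_comp => //; apply: measurable_funM => //.
    exact: measurable_sketch.
  - by apply: emeasurable_sum => f; apply: measurable_funeM.
  - move=> w _; under eq_bigr do rewrite -EFinM; rewrite sumEFin lee_fin.
    have -> : expR (- (s * sqr_frobenius (random_mx g w *m E))) =
        \prod_i expR (\sum_k p k * - y i k w).
      rewrite /sqr_frobenius mulr_sumr -sumrN -expR_sum; congr expR.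
      apply: eq_bigr => i _; rewrite mulr_sumr -sumrN; apply: eq_bigr => k _.
      by rewrite mulrN py.
    apply: (@le_trans _ _ (\prod_i \sum_k p k * expR (- y i k w))).
      apply: ler_prod => i _; rewrite expR_ge0 /=.
      exact: expR_jensen.
    rewrite bigA_distr_bigA /=; apply: ler_sum => f _.
    by rewrite big_split /= -expR_sum sumrN.
rewrite ge0_integral_sum//; last 2 first.
- by move=> f; exact: measurable_funeM.
- move=> f w _; apply: mule_ge0; rewrite lee_fin//; exact: expR_ge0.
under eq_bigr => f _.
  rewrite ge0_integralZl//; last by rewrite lee_fin.
  rewrite intY -EFinM -big_split /=.
  rewrite (eq_bigr (fun i => p (f i) * C)); last first.
    (* For a zero column [N (f i)] does not cancel, but the weight [p (f i)] is 0. *)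
    move=> i _; rewrite /p /C; have [->|Nf0] := eqVneq (N (f i)) 0.
      by rewrite !mul0r.
    by congr (_ * (Num.sqrt (1 + _))^-1); field.
  over.
rewrite sumEFin -(bigA_distr_bigA (fun _ k => p k * C)) /=.
by rewrite -mulr_suml p_sum mul1r prodr_const card_ord.
Qed.

End sketch.

(** * Chernoff bound for the lower tail *)

Lemma sketch_lower_tail d (T : measurableType d) (R : realType)
    (P : probability T R) (c m n : nat) (g : 'I_c -> 'I_m -> {RV P >-> R})
    (E : 'M[R]_(m, n)) (t : R) :
  (0 < c)%N -> gaussian_matrix g c%:R^-1 -> 0 <= t -> 0 < sqr_frobenius E ->
  (P [set w | sqr_frobenius (random_mx g w *m E) <
              (1 - 2 * Num.sqrt (t / c%:R)) * sqr_frobenius E]%R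
   <= (expR (- t))%:E)%E.
Proof.
move=> c_gt0 gG t_ge0; set F := sqr_frobenius E => F_gt0.
set r := Num.sqrt _; set b := (1 - 2 * r) * F.
have c0 : 0 < c%:R :> R by rewrite ltr0n.
have r_ge0 : 0 <= r by exact: sqrtr_ge0.
have r2 : c%:R * r ^+ 2 = t.
  by rewrite sqr_sqrtr ?divr_ge0// ?ltW// mulrC divfK// gt_eqF.
(* This [s] minimizes [- 2 * r * (s * F) + (s * F) ^+ 2 / c], the exponent of the final bound; its
   minimum is [- c * r ^+ 2 = - t]. *)
pose s := c%:R * r / F.
have sF : s * F = c%:R * r by rewrite divfK// gt_eqF.
have s_ge0 : 0 <= s by rewrite divr_ge0 ?mulr_ge0// ltW.
have mX := measurable_sketch g E.
have mexp : measurable_fun setT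
    (fun w => (expR (- (s * sqr_frobenius (random_mx g w *m E))))%:E).
  apply/measurable_EFinP; apply: measurableT_comp => //.
  by apply: measurableT_comp => //; exact: measurable_funM.
have mA := measurable_sketch_lt g E b.
set A := [set w | _] in mA *.
(* Exponential Markov inequality: the indicator of [A] is at most [expR] of [s] times [b] minus the
   squared sketch norm. *)
apply: (@le_trans _ _ ((expR (s * b))%:E *
  \int[P]_w (expR (- (s * sqr_frobenius (random_mx g w *m E))))%:E)%E).
  rewrite -ge0_integralZl//.
  rewrite -(setIT A) -integral_indic//.
  apply: ge0_le_integral => //.
  - by apply/measurable_EFinP; exact: measurable_indic.
  - exact: measurable_funeM.
  - move=> w _; rewrite -EFinM lee_fin -expRD indicE.
    have [wA|_] := boolP (w \in A); last exact: expR_ge0.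
    rewrite /= -[leLHS]expR0 ler_expR -mulrBr mulr_ge0// subr_ge0 ltW//.
    by move: wA; rewrite inE.
have v_gt0 : 0 < c%:R^-1 :> R by rewrite invr_gt0.
apply: (le_trans (lee_wpmul2l _ (integral_expR_sketch_le v_gt0 gG s_ge0 F_gt0))).
  by rewrite lee_fin expR_ge0.
rewrite -EFinM lee_fin -/F.
have -> : 2 * s * c%:R^-1 * F = 2 * r.
  transitivity (2 * (s * F) / c%:R); first by ring.
  by rewrite sF; field; rewrite gt_eqF.
apply: (@le_trans _ _ (expR (s * b) * expR (- (2 * r / 2) + (2 * r) ^+ 2 / 4) ^+ c)).
  rewrite ler_pM2l ?expR_gt0// lerXn2r ?nnegrE ?expR_ge0 ?invr_ge0 ?sqrtr_ge0//.
  by rewrite sqrt1D_inv_le// mulr_ge0.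
rewrite -expRM_natl -expRD ler_expR /b mulrCA sF -r2.
by nra.
Qed.

(** * Relative errors and the stopping rule *)

Theorem corollary3p3 (R : realType) (d : measure_display)
    (T : measurableType d) (P : probability T R)
    (delta epsilon alpha : R) (c m n : nat)
    (delta_gt0 : 0 < delta) (epsilon_gt0 : 0 < epsilon)
    (alpha_gt0 : 0 < alpha) (alpha_lt1 : alpha < 1)
    (c_gt0 : (0 < c)%N) (c_gt : - 4 * ln alpha < c%:R)
    (A : 'M[R]_(m, n)) (I : {set 'I_m}) (J : {set 'I_n})
    (g : 'I_c -> 'I_m -> {RV P >-> R})
    (g_gaussian : gaussian_matrix g c%:R^-1)
    (xi : R)
    (xiE : xi = (1 + delta) * Num.sqrt (1 - 2 * Num.sqrt (- ln alpha / c%:R))) :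
  (P [set w | frobenius (random_mx g w *m (A - CUR A I J)) / frobenius A
                < xi * epsilon
              /\ frobenius (A - CUR A I J) / frobenius A
                > (1 + delta) * epsilon]%R
   <= alpha%:E)%E.
Proof.
move: (A - CUR A I J) => E.
(* The residual is deterministic, so its condition either fails and the event is empty, or holds for
   every [w]. *)
have [large|small] := ltP ((1 + delta) * epsilon) (frobenius E / frobenius A);
  last first.
  rewrite (_ : [set w | _] = set0) ?measure0 ?lee_fin ?ltW//.
  by rewrite -subset0 => w /= [].
set t := - ln alpha; set theta := 1 - 2 * Num.sqrt (t / c%:R).
have t_ge0 : 0 <= t by rewrite oppr_ge0 ltW// ln_lt0// alpha_gt0.
have c0 : 0 < c%:R :> R by rewrite ltr0n.
(* The lower bound on [c] gives [t / c < 1 / 4]; hence [Num.sqrt theta] squares back to [theta]. *)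
have theta_ge0 : 0 <= theta.
  have : Num.sqrt (t / c%:R) <= 2^-1.
    rewrite -[leRHS]ger0_norm ?invr_ge0// -sqrtr_sqr ler_sqrt ?sqr_ge0//.
    by rewrite ler_pdivrMr// /t; lra.
  by rewrite /theta; lra.
have lhs_gt0 : 0 < (1 + delta) * epsilon by rewrite mulr_gt0// addr_gt0.
(* Division by zero gives 0, so a zero norm would contradict the positive lower bound in [large]. *)
have A_gt0 : 0 < frobenius A.
  rewrite lt_neqAle sqrtr_ge0 andbT eq_sym; apply: contraTneq large => ->.
  by rewrite invr0 mulr0 -leNgt ltW.
have F_gt0 : 0 < sqr_frobenius E.
  have := lt_trans lhs_gt0 large.
  by rewrite pmulr_lgt0 ?invr_gt0// sqrtr_gt0.
have xi_ge0 : 0 <= xi * epsilon * frobenius A.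
  by rewrite xiE !mulr_ge0 ?sqrtr_ge0// ?ltW// addr_gt0.
pose b := (xi * epsilon * frobenius A) ^+ 2.
rewrite (_ : [set w | _] = [set w | sqr_frobenius (random_mx g w *m E) < b]);
  last first.
  have lt_b w : (frobenius (random_mx g w *m E) / frobenius A < xi * epsilon) =
      (sqr_frobenius (random_mx g w *m E) < b).
    rewrite ltr_pdivrMr// -(@ltr_pXn2r _ 2)// ?nnegrE ?sqrtr_ge0//.
    by rewrite sqr_sqrtr// sqr_frobenius_ge0.
  by apply/seteqP; split => w /=; rewrite lt_b => // -[].
(* The factor [1 + delta] of [xi] completes the threshold in [large]: [b] is [theta] times the
   square of a quantity below [frobenius E]. *)
have b_le : b <= theta * sqr_frobenius E.
  rewrite /b xiE -/theta.
  have -> : (1 + delta) * Num.sqrt theta * epsilon * frobenius A =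
    Num.sqrt theta * ((1 + delta) * epsilon * frobenius A) by ring.
  rewrite exprMn sqr_sqrtr// ler_wpM2l//.
  rewrite -[leRHS]sqr_sqrtr ?sqr_frobenius_ge0// lerXn2r ?nnegrE ?sqrtr_ge0//.
    by rewrite mulr_ge0 ?ltW.
  by rewrite -ler_pdivlMr// ltW.
have <- : expR (- t) = alpha by rewrite opprK lnK.
apply: le_trans (sketch_lower_tail c_gt0 g_gaussian t_ge0 F_gt0).
rewrite le_measure ?inE//; try exact: measurable_sketch_lt.
by move=> w /= /lt_le_trans; exact.
Qed.
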